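(* Let $0<\mu_x\le L_x$, $0<\mu_y\le L_y$ and $L_{xy}\ge0$. There exists a $6$-dimensional function $f\in\mathcal F(\mu_x,\mu_y,L_x,L_y,L_{xy})$ with $d_x=d_y=3$ such that for any constant step sizes $\alpha,\beta>0$, the convergence of EG requires an iteration complexity of rate at least $$\Omega\left(\left(\kappa_x+\kappa_y+\kappa_{xy}\right)\cdot\log\frac1\epsilon\right)$$ in order to have $\|z_K-z_\star\|^2\le\epsilon$.
   Context: Function class. For $0<\mu_x\le L_x$, $0<\mu_y\le L_y$, $L_{xy}\ge0$, $\mathcal F(\mu_x,\mu_y,L_x,L_y,L_{xy})$ is the set of all twice-differentiable $f:\mathbb R^{d_x}\times\mathbb R^{d_y}\to\mathbb R$ such that: (i) $f(\cdot,y)$ is $\mu_x$-strongly convex for every $y$ and $f(x,\cdot)$ is $\mu_y$-strongly concave for every $x$ ($g$ is $\mu$-strongly convex if $g(z')\ge g(z)+\langle\nabla g(z),z'-z\rangle+\frac\mu2\|z'-z\|^2$ for all $z,z'$; $g$ is $\mu$-strongly concave if $-g$ is $\mu$-strongly convex); (ii) for all $x,x',y,y'$: $\|\nabla_xf(x',y)-\nabla_xf(x,y)\|\le L_x\|x'-x\|$, $\|\nabla_yf(x,y')-\nabla_yf(x,y)\|\le L_y\|y'-y\|$, $\|\nabla_xf(x,y')-\nabla_xf(x,y)\|\le L_{xy}\|y'-y\|$, $\|\nabla_yf(x',y)-\nabla_yf(x,y)\|\le L_{xy}\|x'-x\|$. Norms are Euclidean. Every such $f$ has a unique Nash equilibrium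 $z_\star=(x_\star,y_\star)$, i.e. a point with $f(x_\star,y)\le f(x_\star,y_\star)\le f(x,y_\star)$ for all $x,y$. Condition numbers: $\kappa_x=L_x/\mu_x$, $\kappa_y=L_y/\mu_y$, $\kappa_{xy}=L_{xy}/\sqrt{\mu_x\mu_y}$. EG (Extra-gradient) with constant step sizes $\alpha,\beta>0$: $x_{k+1/2}=x_k-\alpha\nabla_xf(x_k,y_k)$, $y_{k+1/2}=y_k+\beta\nabla_yf(x_k,y_k)$, $x_{k+1}=x_k-\alpha\nabla_xf(x_{k+1/2},y_{k+1/2})$, $y_{k+1}=y_k+\beta\nabla_yf(x_{k+1/2},y_{k+1/2})$; $z_k=(x_k,y_k)$. The iteration complexity is the number $K$ of iterations needed to have $\|z_K-z_\star\|^2\le\epsilon$; $\Omega$ is the conventional asymptotic notation. *)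

(* Defs.v *)
From mathcomp Require Import all_boot all_order all_algebra.
From mathcomp Require Import all_classical all_reals all_analysis.
Import Order.TTheory GRing.Theory Num.Theory.
Import numFieldNormedType.Exports.

Set Implicit Arguments.
Unset Strict Implicit.
Unset Printing Implicit Defensive.

Local Open Scope ring_scope.

Section Euclidean.
Variable R : realType.

Definition dot (n : nat) (u v : 'rV[R]_n) : R := \sum_(i < n) u 0 i * v 0 i.

(* The library norm on 'rV[R]_n is the sup norm, which has the same
   differentiable functions but is not the Euclidean norm. *)
Definition enorm (n : nat) (u : 'rV[R]_n) : R := Num.sqrt (dot u u).

(* Likewise the library norm on a product is the max of the two norms. *)
Definition enorm2 (m n : nat) (z : 'rV[R]_m * 'rV[R]_n) : R :=
  Num.sqrt (enorm z.1 ^+ 2 + enorm z.2 ^+ 2).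

Definition grad (n : nat) (g : 'rV[R]_n -> R) (x : 'rV[R]_n) : 'rV[R]_n :=
  \row_(i < n) 'D_(delta_mx 0 i) g x.

Definition strongly_convex (n : nat) (mu : R) (g : 'rV[R]_n -> R) : Prop :=
  forall z z' : 'rV[R]_n,
    g z + dot (grad g z) (z' - z) + mu / 2 * enorm (z' - z) ^+ 2 <= g z'.

Definition strongly_concave (n : nat) (mu : R) (g : 'rV[R]_n -> R) : Prop :=
  strongly_convex mu (fun z => - g z).

End Euclidean.

Section Minimax.
Variables (R : realType) (dx dy : nat).
Implicit Types (f : 'rV[R]_dx * 'rV[R]_dy -> R).

Definition gradx f (z : 'rV[R]_dx * 'rV[R]_dy) : 'rV[R]_dx :=
  grad (fun x => f (x, z.2)) z.1.

Definition grady f (z : 'rV[R]_dx * 'rV[R]_dy) : 'rV[R]_dy :=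
  grad (fun y => f (z.1, y)) z.2.

(* In finite dimension, Frechet differentiability of the derivative is the
   same as that of the full gradient map. *)
Definition twice_differentiable f : Prop :=
  (forall z, differentiable f z) /\
  (forall z, differentiable (fun w => (gradx f w, grady f w)) z).

Record minimax_class (mux muy Lx Ly Lxy : R) f : Prop := MinimaxClass {
  mc_diff2 : twice_differentiable f;
  mc_cvx : forall y, strongly_convex mux (fun x => f (x, y));
  mc_ccv : forall x, strongly_concave muy (fun y => f (x, y));
  mc_Lx : forall x x' y,
    enorm (gradx f (x', y) - gradx f (x, y)) <= Lx * enorm (x' - x);
  mc_Ly : forall x y y',
    enorm (grady f (x, y') - grady f (x, y)) <= Ly * enorm (y' - y);
  mc_Lxy : forall x y y',
    enorm (gradx f (x, y') - gradx f (x, y)) <= Lxy * enorm (y' - y);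
  mc_Lyx : forall x x' y,
    enorm (grady f (x', y) - grady f (x, y)) <= Lxy * enorm (x' - x)
}.

Definition nash_equilibrium f (zs : 'rV[R]_dx * 'rV[R]_dy) : Prop :=
  forall x y, f (zs.1, y) <= f zs /\ f zs <= f (x, zs.2).

Definition EG_step f (alpha beta : R) (z : 'rV[R]_dx * 'rV[R]_dy) :=
  let zh := (z.1 - alpha *: gradx f z, z.2 + beta *: grady f z) in
  (z.1 - alpha *: gradx f zh, z.2 + beta *: grady f zh).

Definition EG f (alpha beta : R) (z0 : 'rV[R]_dx * 'rV[R]_dy) (k : nat) :=
  iter k (EG_step f alpha beta) z0.

End Minimax.

(* Main.v *)
(* On a separable quadratic saddle function EG acts coordinate by coordinate.
   Take three pairs [(x_i, y_i)] with curvatures and coupling [(Lx, Ly, 0)],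
   [(mux, muy, 0)] and [(mux, muy, Lxy)], and start from equal coordinates.
   On an uncoupled coordinate of curvature [h], EG multiplies by
   [p t = 1 - t + t^2 >= max (3/4, 1 - t)], [t = alpha h]. The first pair
   forces [alpha Lx, beta Ly < 1], so the second pair contracts at rate at most
   [O (1 / kx)] in [x] and [O (1 / ky)] in [y]. On the coupled pair an area
   form is multiplied by [\det T], which is at least 1 when
   [alpha beta Lxy^2 >= 4], so such step sizes fail; otherwise one of
   [alpha mux], [beta muy] is below [2 / kxy] and the second pair is slow. *)
From HB Require Import structures.
Require Import Defs.
From mathcomp Require Import all_boot all_order all_algebra.
From mathcomp Require Import all_classical all_reals all_analysis.
From mathcomp Require Import ring lra.
Import Order.TTheory GRing.Theory Num.Theory.
Import numFieldNormedType.Exports.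

Local Open Scope ring_scope.

(** * Coordinatewise control of the Euclidean norm *)

Section EuclideanNorm.
Context {R : realType} {n : nat}.
Implicit Types u v : 'rV[R]_n.

Lemma dot_ge0 u : 0 <= dot u u.
Proof. by apply: sumr_ge0 => i _; rewrite -expr2 sqr_ge0. Qed.

Lemma enorm_ge0 u : 0 <= enorm u.
Proof. exact: sqrtr_ge0. Qed.

Lemma enorm_sqr u : enorm u ^+ 2 = \sum_(i < n) u 0 i ^+ 2.
Proof. by rewrite sqr_sqrtr ?dot_ge0. Qed.

(** Reduces each Lipschitz condition to one coordinate, since increments of the saddle gradients are
    diagonal. *)
Lemma enorm_le (L : R) u v : 0 <= L ->
  (forall i, `|u 0 i| <= L * `|v 0 i|) -> enorm u <= L * enorm v.
Proof.
move=> L0 uv; rewrite -ler_sqr ?nnegrE ?mulr_ge0 ?enorm_ge0//.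
rewrite exprMn !enorm_sqr mulr_sumr; apply: ler_sum => i _.
rewrite -(real_normK (num_real (u 0 i))) -(real_normK (num_real (v 0 i))).
by rewrite -exprMn ler_sqr ?nnegrE ?mulr_ge0 ?normr_ge0.
Qed.

End EuclideanNorm.

(** * Differentiability of coordinates and projections *)

Lemma is_derive_coord {R : realType} {n : nat} (x v : 'rV[R]_n) (j : 'I_n) :
  is_derive x v (fun y : 'rV[R]_n => y 0 j) (v 0 j).
Proof.
pose L := GRing.isLinear.Build R 'rV[R]_n R *%R (fun y => y 0 j)
  ltac:(by move=> a u w; rewrite !mxE).
pose f : {linear 'rV[R]_n -> R} := HB.pack (fun y : 'rV[R]_n => y 0 j) L.
have fC : continuous f by exact: coord_continuous.
apply: DeriveDef; first exact/diff_derivable/differentiable_coord.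
by rewrite deriveE ?(diff_lin _ fC)//; exact: differentiable_coord.
Qed.

Lemma differentiable_fst {R : realType} {V W : normedModType R} (z : V * W) :
  differentiable fst z.
Proof.
pose L := GRing.isLinear.Build R (V * W)%type V *:%R fst
  ltac:(by move=> a u w).
pose f : {linear (V * W)%type -> V} := HB.pack fst L.
by apply: (@linear_differentiable _ _ _ f) => ?; exact: cvg_fst.
Qed.

Lemma differentiable_snd {R : realType} {V W : normedModType R} (z : V * W) :
  differentiable snd z.
Proof.
pose L := GRing.isLinear.Build R (V * W)%type W *:%R snd
  ltac:(by move=> a u w).
pose f : {linear (V * W)%type -> W} := HB.pack snd L.
by apply: (@linear_differentiable _ _ _ f) => ?; exact: cvg_snd.
Qed.

(** * Calculus of separable quadratics *)

Section SeparableQuadratic.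
Context {R : realType} {n : nat}.
Implicit Types (p q r : 'I_n -> R) (x : 'rV[R]_n).

Definition sepquad p q r x : R :=
  \sum_(i < n) (p i * x 0 i ^+ 2 + q i * x 0 i + r i).

Lemma grad_sepquad p q r x i :
  grad (sepquad p q r) x 0 i = 2 * p i * x 0 i + q i.
Proof.
have -> : sepquad p q r = \sum_(j < n) fun y : 'rV[R]_n =>
    p j * y 0 j ^+ 2 + q j * y 0 j + r j.
  by apply/funext => y; rewrite fct_sumE.
have coordD j : is_derive x (delta_mx 0 i) (fun y : 'rV[R]_n => y 0 j)
    (i == j)%:R.
  rewrite (_ : (i == j)%:R = (delta_mx 0 i : 'rV[R]_n) 0 j); last first.
    by rewrite mxE eqxx eq_sym.
  exact: is_derive_coord.
(* Stating the value with index [i] instead of [j] is harmless thanks to the indicator, and makes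
   the sum collapse to one term. *)
have termD j : is_derive x (delta_mx 0 i)
    (fun y : 'rV[R]_n => p j * y 0 j ^+ 2 + q j * y 0 j + r j)
    ((2 * p i * x 0 i + q i) * (i == j)%:R).
  have := is_deriveD (is_deriveD
    (is_deriveZ (p j) (is_deriveX 2 (coordD j)))
    (is_deriveZ (q j) (coordD j))) (is_derive_cst (r j) x (delta_mx 0 i)).
  move=> H; apply: (is_derive_eq H).
  rewrite expr1 addr0 /GRing.scale/=.
  by case: eqVneq => [->|_]; rewrite ?mulr1n ?mulr0n; ring.
rewrite mxE derive_val (bigD1 i)//= eqxx mulr1 big1 ?addr0// => j ji.
by rewrite eq_sym (negbTE ji) mulr0.
Qed.

Lemma strongly_convex_sepquad (mu : R) p q r :
  (forall i, mu <= 2 * p i) -> strongly_convex mu (sepquad p q r).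
Proof.
move=> mup z z'.
rewrite enorm_sqr -subr_ge0 /dot /sepquad mulr_sumr -!big_split/=.
rewrite -sumrB; apply: sumr_ge0 => i _; rewrite grad_sepquad !mxE.
(* The gap in the convexity inequality at coordinate [i] is exactly half of this product. *)
have : 0 <= (2 * p i - mu) * (z' 0 i - z 0 i) ^+ 2.
  by rewrite mulr_ge0 ?sqr_ge0// subr_ge0.
by lra.
Qed.

End SeparableQuadratic.

(** * Diagonal quadratic saddle functions: gradients and smoothness *)

Section DiagonalSaddle.
Context {R : realType} {n : nat}.
Variables (hx hy l : 'I_n -> R).
Implicit Types (x y : 'rV[R]_n) (z : 'rV[R]_n * 'rV[R]_n).

Definition saddle z : R := \sum_(i < n)
  (hx i / 2 * z.1 0 i ^+ 2 + l i * z.1 0 i * z.2 0 i - hy i / 2 * z.2 0 i ^+ 2).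

Lemma saddle_x y : (fun x => saddle (x, y)) =
  sepquad (fun i => hx i / 2) (fun i => l i * y 0 i)
          (fun i => - (hy i / 2 * y 0 i ^+ 2)).
Proof. by apply/funext => x; apply: eq_bigr => i _ /=; ring. Qed.

Lemma saddle_y x : (fun y => saddle (x, y)) =
  sepquad (fun i => - (hy i / 2)) (fun i => l i * x 0 i)
          (fun i => hx i / 2 * x 0 i ^+ 2).
Proof. by apply/funext => y; apply: eq_bigr => i _ /=; ring. Qed.

Lemma saddle_yN x : (fun y => - saddle (x, y)) =
  sepquad (fun i => hy i / 2) (fun i => - (l i * x 0 i))
          (fun i => - (hx i / 2 * x 0 i ^+ 2)).
Proof.
by apply/funext => y; rewrite -sumrN; apply: eq_bigr => i _ /=; ring.
Qed.

Lemma gradx_saddle z i :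
  gradx saddle z 0 i = hx i * z.1 0 i + l i * z.2 0 i.
Proof. by rewrite /gradx saddle_x grad_sepquad; field. Qed.

Lemma grady_saddle z i :
  grady saddle z 0 i = l i * z.1 0 i - hy i * z.2 0 i.
Proof. by rewrite /grady saddle_y grad_sepquad; field. Qed.

Lemma differentiable_coord1 i z :
  differentiable (fun w : 'rV[R]_n * 'rV[R]_n => w.1 0 i) z.
Proof.
apply: (@differentiable_comp _ _ _ _ fst (fun x : 'rV[R]_n => x 0 i)).
  exact: differentiable_fst.
exact: differentiable_coord.
Qed.

Lemma differentiable_coord2 i z :
  differentiable (fun w : 'rV[R]_n * 'rV[R]_n => w.2 0 i) z.
Proof.
apply: (@differentiable_comp _ _ _ _ snd (fun x : 'rV[R]_n => x 0 i)).
  exact: differentiable_snd.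
exact: differentiable_coord.
Qed.

Lemma differentiable_row (V : normedModType R) (g : V -> 'rV[R]_n) (v : V) :
  (forall i, differentiable (fun w => g w 0 i) v) -> differentiable g v.
Proof.
move=> dg.
have -> : g = \sum_(i < n) fun w => g w 0 i *: (delta_mx 0 i : 'rV[R]_n).
  by apply/funext => w; rewrite fct_sumE [LHS]row_sum_delta.
by apply: differentiable_sum => i; apply: differentiableZl.
Qed.

Lemma twice_differentiable_saddle : twice_differentiable saddle.
Proof.
split=> z.
  have -> : saddle = \sum_(i < n) fun w : 'rV[R]_n * 'rV[R]_n =>
      hx i / 2 * (w.1 0 i * w.1 0 i) + l i * (w.1 0 i * w.2 0 i)
      - hy i / 2 * (w.2 0 i * w.2 0 i).
    by apply/funext => w; rewrite fct_sumE; apply: eq_bigr => i _; ring.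
  have d1 := differentiable_coord1; have d2 := differentiable_coord2.
  apply: differentiable_sum => i; apply: differentiableB.
    by apply: differentiableD; apply: differentiableM => //;
       apply: differentiableM.
  by apply: differentiableM => //; apply: differentiableM.
apply: differentiable_pair; apply: differentiable_row => i.
  rewrite (_ : (fun _ => _) = fun w : 'rV[R]_n * 'rV[R]_n =>
    hx i * w.1 0 i + l i * w.2 0 i); last first.
    by apply/funext => w; exact: gradx_saddle.
  apply: differentiableD; apply: differentiableM => //.
  exact: differentiable_coord1. exact: differentiable_coord2.
rewrite (_ : (fun _ => _) = fun w : 'rV[R]_n * 'rV[R]_n =>
    l i * w.1 0 i - hy i * w.2 0 i); last first.
  by apply/funext => w; exact: grady_saddle.
apply: differentiableB; apply: differentiableM => //.
exact: differentiable_coord1. exact: differentiable_coord2.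
Qed.

End DiagonalSaddle.

(** * Class membership and equilibrium of the saddle function *)

Section SaddleClass.
Context {R : realType} {n : nat}.
Variables (hx hy l : 'I_n -> R).

Lemma minimax_class_saddle (mux muy Lx Ly Lxy : R) : (0 < n)%N ->
  0 < mux -> 0 < muy ->
  (forall i, mux <= hx i <= Lx) -> (forall i, muy <= hy i <= Ly) ->
  (forall i, 0 <= l i <= Lxy) ->
  minimax_class mux muy Lx Ly Lxy (saddle hx hy l).
Proof.
move=> n0 mux0 muy0 hxB hyB lB.
have [Lx0 Ly0 Lxy0] : [/\ 0 <= Lx, 0 <= Ly & 0 <= Lxy].
  have i := Ordinal n0; have := hxB i; have := hyB i; have := lB i.
  by move=> /andP[? ?] /andP[? ?] /andP[? ?]; split; lra.
have hx0 i : `|hx i| <= Lx.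
  by have /andP[? ?] := hxB i; rewrite ger0_norm//; lra.
have hy0 i : `|hy i| <= Ly.
  by have /andP[? ?] := hyB i; rewrite ger0_norm//; lra.
have l0 i : `|l i| <= Lxy by have /andP[? ?] := lB i; rewrite ger0_norm.
have subE (u v : 'rV[R]_n) i : (u - v) 0 i = u 0 i - v 0 i by rewrite !mxE.
split.
- exact: twice_differentiable_saddle.
- move=> y; rewrite saddle_x; apply: strongly_convex_sepquad => i.
  by have /andP[? ?] := hxB i; lra.
- move=> x; rewrite /strongly_concave saddle_yN.
  apply: strongly_convex_sepquad => i.
  by have /andP[? ?] := hyB i; lra.
- move=> x x' y; apply: enorm_le => // i.
  rewrite !subE !(gradx_saddle, grady_saddle)/=.
  rewrite (_ : _ - _ = hx i * (x' 0 i - x 0 i)); last by ring.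
  by rewrite normrM ler_wpM2r.
- move=> x y y'; apply: enorm_le => // i.
  rewrite !subE !(gradx_saddle, grady_saddle)/=.
  rewrite (_ : _ - _ = - (hy i * (y' 0 i - y 0 i))); last by ring.
  by rewrite normrN normrM ler_wpM2r.
- move=> x y y'; apply: enorm_le => // i.
  rewrite !subE !(gradx_saddle, grady_saddle)/=.
  rewrite (_ : _ - _ = l i * (y' 0 i - y 0 i)); last by ring.
  by rewrite normrM ler_wpM2r.
- move=> x x' y; apply: enorm_le => // i.
  rewrite !subE !(gradx_saddle, grady_saddle)/=.
  rewrite (_ : _ - _ = l i * (x' 0 i - x 0 i)); last by ring.
  by rewrite normrM ler_wpM2r.
Qed.

Lemma nash_equilibrium_saddle :
  (forall i, 0 <= hx i) -> (forall i, 0 <= hy i) ->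
  nash_equilibrium (saddle hx hy l) (0, 0).
Proof.
move=> hx0 hy0 x y; rewrite (_ : saddle _ _ _ (0, 0) = 0); last first.
  by apply: big1 => i _; rewrite !mxE; ring.
split; [rewrite -oppr_ge0 -sumrN|]; apply: sumr_ge0 => i _; rewrite !mxE.
  have : 0 <= hy i * y 0 i ^+ 2 by rewrite mulr_ge0 ?sqr_ge0.
  by lra.
have : 0 <= hx i * x 0 i ^+ 2 by rewrite mulr_ge0 ?sqr_ge0.
by lra.
Qed.

End SaddleClass.

(** * Extra-gradient dynamics on each coordinate pair *)

Section ExtraGradient.
Context {R : realType} {n : nat}.
Variables (hx hy l : 'I_n -> R) (alpha beta : R).
Implicit Types (z : 'rV[R]_n * 'rV[R]_n) (i : 'I_n) (k : nat).

Let addZE (u v : 'rV[R]_n) a i : (u + a *: v) 0 i = u 0 i + a * v 0 i.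
Proof. by rewrite !mxE. Qed.

Let subZE (u v : 'rV[R]_n) a i : (u - a *: v) 0 i = u 0 i - a * v 0 i.
Proof. by rewrite !mxE. Qed.

Lemma EG_step_saddle_x z i : (EG_step (saddle hx hy l) alpha beta z).1 0 i =
  z.1 0 i - alpha *
    (hx i * (z.1 0 i - alpha * (hx i * z.1 0 i + l i * z.2 0 i)) +
     l i * (z.2 0 i + beta * (l i * z.1 0 i - hy i * z.2 0 i))).
Proof.
by rewrite /= subZE gradx_saddle/= subZE addZE gradx_saddle grady_saddle.
Qed.

Lemma EG_step_saddle_y z i : (EG_step (saddle hx hy l) alpha beta z).2 0 i =
  z.2 0 i + beta *
    (l i * (z.1 0 i - alpha * (hx i * z.1 0 i + l i * z.2 0 i)) -
     hy i * (z.2 0 i + beta * (l i * z.1 0 i - hy i * z.2 0 i))).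
Proof.
by rewrite /= addZE grady_saddle/= subZE addZE gradx_saddle grady_saddle.
Qed.

Lemma EG_uncoupled_x z i k : l i = 0 ->
  (EG (saddle hx hy l) alpha beta z k).1 0 i =
  (1 - alpha * hx i + (alpha * hx i) ^+ 2) ^+ k * z.1 0 i.
Proof.
move=> li0; elim: k => [|k IH]; first by rewrite mul1r.
by rewrite /EG iterS EG_step_saddle_x -/(EG _ _ _ _ _) IH li0 (exprS _ k); ring.
Qed.

Lemma EG_uncoupled_y z i k : l i = 0 ->
  (EG (saddle hx hy l) alpha beta z k).2 0 i =
  (1 - beta * hy i + (beta * hy i) ^+ 2) ^+ k * z.2 0 i.
Proof.
move=> li0; elim: k => [|k IH]; first by rewrite mul1r.
by rewrite /EG iterS EG_step_saddle_y -/(EG _ _ _ _ _) IH li0 (exprS _ k); ring.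
Qed.

(* The area form [A z /\ z], where [A] is the 2x2 matrix of the scaled saddle
   operator on the [i]-th pair of coordinates. *)
Definition swept_area z i : R :=
  beta * l i * z.1 0 i ^+ 2
  + (alpha * hx i - beta * hy i) * z.1 0 i * z.2 0 i
  + alpha * l i * z.2 0 i ^+ 2.

(* The step acts as [T = 1 - A + A^2], which commutes with [A], so the area
   form is multiplied by [\det T], written here with [s = \tr A] and
   [D = \det A]. *)
Lemma swept_area_EG z i k :
  let s := alpha * hx i + beta * hy i in
  let D := alpha * beta * (hx i * hy i + l i ^+ 2) in
  swept_area (EG (saddle hx hy l) alpha beta z k) i =
  (1 - s + s ^+ 2 - D - D * s + D ^+ 2) ^+ k * swept_area z i.
Proof.
move=> s D; elim: k => [|k IH]; first by rewrite mul1r.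
rewrite (exprS _ k) -mulrA -IH /EG iterS -/(EG _ _ _ _ _) /swept_area.
by rewrite EG_step_saddle_x EG_step_saddle_y /s /D; ring.
Qed.

End ExtraGradient.

Lemma enorm2_sqr {R : realType} {m n : nat} (z : 'rV[R]_m * 'rV[R]_n) :
  enorm2 z ^+ 2 = \sum_(i < m) z.1 0 i ^+ 2 + \sum_(j < n) z.2 0 j ^+ 2.
Proof. by rewrite sqr_sqrtr ?addr_ge0 ?sqr_ge0// !enorm_sqr. Qed.

Lemma le_enorm2_sqr {R : realType} {m n : nat} (z : 'rV[R]_m * 'rV[R]_n) i j :
  z.1 0 i ^+ 2 + z.2 0 j ^+ 2 <= enorm2 z ^+ 2.
Proof.
rewrite enorm2_sqr; apply: lerD; [rewrite (bigD1 i)//=|rewrite (bigD1 j)//=];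
  by rewrite lerDl; apply: sumr_ge0 => ? _; exact: sqr_ge0.
Qed.

(** * Contraction rates of uncoupled coordinates *)

Section Rates.
Context {R : realType}.
Implicit Types (t eps : R) (k : nat).

(* [ln (1 / p) <= 1 / p - 1] with [p = 1 - t + t^2 >= 3 / 4]. *)
Lemma expR_le_EG_factor t : 0 <= t -> expR (- (4 / 3 * t)) <= 1 - t + t ^+ 2.
Proof.
move=> t0; have p34 : 3 / 4 <= 1 - t + t ^+ 2.
  by have := sqr_ge0 (t - 1 / 2); lra.
set p := 1 - t + t ^+ 2 in p34 *; have p0 : 0 < p by lra.
rewrite expRN -[leRHS]invrK lef_pV2 ?posrE ?invr_gt0 ?expR_gt0//.
apply: (@le_trans _ _ (expR (p^-1 - 1))).
  by have := expR_ge1Dx (p^-1 - 1); lra.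
rewrite ler_expR -(ler_pM2r p0) mulrBl mulVf ?gt_eqF// mul1r.
have := mulr_ge0 t0 (_ : 0 <= p - 3 / 4); rewrite subr_ge0 p34 => /(_ isT).
by have := sqr_ge0 t; rewrite /p; lra.
Qed.

(** The [1 / 6] is the initial squared coordinate. Each step shrinks the square by at most
    [expR (- (8 / 3 * t))]. *)
Lemma ln_le_EG_rate t eps k : 0 <= t -> 0 < eps < 1 / 36 ->
  ((1 - t + t ^+ 2) ^+ k) ^+ 2 / 6 <= eps -> ln (1 / eps) <= 16 / 3 * t * k%:R.
Proof.
move=> t0 /andP[e0 e1] pe.
have eE : expR (- (8 / 3 * t * k%:R)) <= 6 * eps.
  rewrite -ler_pdivrMl// mulrC; apply: le_trans pe.
  rewrite ler_pM2r ?invr_gt0// -exprM mulnC exprM.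
  rewrite (_ : - _ = - (4 / 3 * t) * 2 * k%:R); last by field.
  rewrite !expRM_natr.
  rewrite -!exprM; apply: lerXn2r; rewrite ?nnegrE ?expR_ge0//; first by nra.
  exact: expR_le_EG_factor.
(* Squaring [eE] doubles the rate and absorbs the constant 6: [36 * eps ^+ 2 <= eps] because
   [eps < 1 / 36]. *)
have : expR (- (16 / 3 * t * k%:R)) <= eps.
  rewrite (_ : - _ = - (8 / 3 * t * k%:R) + - (8 / 3 * t * k%:R)); last first.
    by field.
  rewrite expRD; have := expR_ge0 (- (8 / 3 * t * k%:R)); nra.
rewrite -[X in _ <= X](lnK e0) ler_expR div1r lnV ?posrE//; lra.
Qed.

(** For [t >= 1] the factor is at least 1, so the left side is at least [1 / 6 > eps]. *)
Lemma EG_factor_stable t eps k : eps < 1 / 36 ->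
  ((1 - t + t ^+ 2) ^+ k) ^+ 2 / 6 <= eps -> t < 1.
Proof.
move=> e1; apply: contraPlt => t1; apply/negP; rewrite -ltNge.
have : 1 <= ((1 - t + t ^+ 2) ^+ k) ^+ 2 by rewrite !exprn_ege1//; nra.
lra.
Qed.

End Rates.

(** The area form never decreases here. With [S = alpha * l i + beta * l i >= 4] it starts above
    [(S - 1) / 6], whereas a squared norm below [1 / 36] would bound it by [(S + 1 / 2) / 36]. *)
Lemma EG_coupled_far {R : realType} {n : nat} (hx hy l : 'I_n -> R)
  (alpha beta : R) (z : 'rV[R]_n * 'rV[R]_n) (i : 'I_n) (k : nat) :
  0 < alpha -> 0 < beta -> 0 <= l i ->
  0 < alpha * hx i < 1 -> 0 < beta * hy i < 1 ->
  4 <= alpha * beta * l i ^+ 2 ->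
  z.1 0 i ^+ 2 = 1 / 6 -> z.2 0 i = z.1 0 i ->
  let z' := EG (saddle hx hy l) alpha beta z k in
  1 / 36 <= z'.1 0 i ^+ 2 + z'.2 0 i ^+ 2.
Proof.
move=> al0 be0 l0 /andP[a0 a1] /andP[b0 b1] cd4 zx zy /=.
set z' := EG _ _ _ _ _.
have := swept_area_EG hx hy l alpha beta z i k; rewrite /= -/z'.
move: a0 a1 b0 b1; set a := alpha * hx i; set b := beta * hy i.
move=> a0 a1 b0 b1; set D := alpha * beta * _; have D4 : 4 <= D.
  have := mulr_gt0 a0 b0.
  by rewrite (_ : D = a * b + alpha * beta * l i ^+ 2) /D /a /b; [lra|ring].
set det := (X in X ^+ k) => areaE.
have det1 : 1 <= det.
  (* With [s = a + b < 2], [det] is this product plus [s ^+ 2 - 5 * s + 13], which exceeds 1. *)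
  have : 0 <= (D - 4) * (D + (3 - (a + b))) by apply: mulr_ge0; lra.
  have := sqr_ge0 (a + b - 1 / 2); rewrite /det; lra.
have cge0 : 0 <= alpha * l i by rewrite mulr_ge0// ltW.
have dge0 : 0 <= beta * l i by rewrite mulr_ge0// ltW.
have S4 : 4 <= alpha * l i + beta * l i.
  rewrite -ler_sqr ?nnegrE ?addr_ge0//.
  by have := sqr_ge0 (alpha * l i - beta * l i); lra.
have area0 : swept_area hx hy l alpha beta z i =
    (alpha * l i + beta * l i + (a - b)) / 6.
  rewrite -[6^-1]div1r -zx /swept_area zy /a /b; ring.
have : swept_area hx hy l alpha beta z i <= swept_area hx hy l alpha beta z' i.
  by rewrite areaE ler_peMl ?exprn_ege1// area0 divr_ge0//; lra.
rewrite area0 /swept_area -/a -/b.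
set x := z'.1 0 i; set y := z'.2 0 i => le_area.
rewrite leNgt; apply/negP => Nlt.
have : 0 <= alpha * l i * x ^+ 2 by rewrite mulr_ge0 ?sqr_ge0.
have : 0 <= beta * l i * y ^+ 2 by rewrite mulr_ge0 ?sqr_ge0.
(* Young's inequality, using that [a - b] lies between -1 and 1. *)
have : (a - b) * x * y <= (x ^+ 2 + y ^+ 2) / 2.
  have : 0 <= (1 - (a - b)) * (x + y) ^+ 2.
    by rewrite mulr_ge0 ?sqr_ge0//; lra.
  have : 0 <= (1 + (a - b)) * (x - y) ^+ 2.
    by rewrite mulr_ge0 ?sqr_ge0//; lra.
  lra.
have : 0 <= (alpha * l i + beta * l i) * (1 / 36 - (x ^+ 2 + y ^+ 2)).
  by apply: mulr_ge0; lra.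
lra.
Qed.

(** * The three-pair instance and its lower bound *)

Theorem proposition5p4 (R : realType) :
  exists c eps0 : R, 0 < c /\ 0 < eps0 /\
  forall mux muy Lx Ly Lxy : R,
    0 < mux -> mux <= Lx -> 0 < muy -> muy <= Ly -> 0 <= Lxy ->
    let kx := Lx / mux in
    let ky := Ly / muy in
    let kxy := Lxy / Num.sqrt (mux * muy) in
    exists f : 'rV[R]_3 * 'rV[R]_3 -> R,
      minimax_class mux muy Lx Ly Lxy f /\
      exists zs : 'rV[R]_3 * 'rV[R]_3, nash_equilibrium f zs /\
      exists z0 : 'rV[R]_3 * 'rV[R]_3, enorm2 (z0 - zs) = 1 /\
      forall alpha beta : R, 0 < alpha -> 0 < beta ->
      forall (eps : R) (K : nat), 0 < eps -> eps < eps0 ->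
        enorm2 (EG f alpha beta z0 K - zs) ^+ 2 <= eps ->
        c * ((kx + ky + kxy) * ln (1 / eps)) <= K%:R.
Proof.
(* The terms in [kx], [ky] and [kxy] cost [16 / 3], [16 / 3] and [32 / 3] times [K], in total
   [64 / 3]. *)
exists (3 / 64), (1 / 36); do 2![split; first by []].
move=> mux muy Lx Ly Lxy mux0 muxL muy0 muyL Lxy0 kx ky kxy.
pose hx (i : 'I_3) := if i == 0 then Lx else mux.
pose hy (i : 'I_3) := if i == 0 then Ly else muy.
pose l (i : 'I_3) := if i == 2 then Lxy else 0.
exists (saddle hx hy l); split.
  apply: minimax_class_saddle => // i.
  - by rewrite /hx; case: ifP; rewrite lexx ?andbT.
  - by rewrite /hy; case: ifP; rewrite lexx ?andbT.
  - by rewrite /l; case: ifP; rewrite lexx ?andbT.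
exists (0, 0); split.
  apply: nash_equilibrium_saddle => i.
  - by rewrite /hx; case: ifP => _; lra.
  - by rewrite /hy; case: ifP => _; lra.
(* Six equal coordinates of square [1 / 6] give a start at distance 1. *)
pose w : R := Num.sqrt (1 / 6); have w2 : w ^+ 2 = 1 / 6 by rewrite sqr_sqrtr.
have sub00 z : z - (0, 0) = z :> 'rV[R]_3 * 'rV[R]_3 by exact: subr0.
exists (const_mx w, const_mx w); split.
  rewrite sub00 -[LHS]ger0_norm ?sqrtr_ge0// -sqrtr_sqr enorm2_sqr.
  have sumE : \sum_(i < 3) (const_mx w : 'rV[R]_3) 0 i ^+ 2 = 1 / 2.
    by under eq_bigr do rewrite mxE w2; rewrite sumr_const card_ord; field.
  by rewrite /= sumE -[RHS]sqrtr1; congr Num.sqrt; field.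
move=> alpha beta al0 be0 eps K e0 e1; rewrite sub00.
set z0 := (const_mx w, const_mx w); set z := EG _ _ _ _ _ => ze.
have xi i : z.1 0 i ^+ 2 <= eps.
  apply: le_trans ze; apply: le_trans (le_enorm2_sqr z i i).
  by rewrite lerDl sqr_ge0.
have yi i : z.2 0 i ^+ 2 <= eps.
  apply: le_trans ze; apply: le_trans (le_enorm2_sqr z i i).
  by rewrite lerDr sqr_ge0.
have xE i : l i = 0 ->
    ((1 - alpha * hx i + (alpha * hx i) ^+ 2) ^+ K) ^+ 2 / 6 <= eps.
  move=> li; have := xi i; rewrite /z EG_uncoupled_x// exprMn mxE w2.
  by rewrite div1r.
have yE i : l i = 0 ->
    ((1 - beta * hy i + (beta * hy i) ^+ 2) ^+ K) ^+ 2 / 6 <= eps.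
  move=> li; have := yi i; rewrite /z EG_uncoupled_y// exprMn mxE w2.
  by rewrite div1r.
have aL : alpha * Lx < 1 by exact: EG_factor_stable _ _ _ e1 (xE 0 erefl).
have bL : beta * Ly < 1 by exact: EG_factor_stable _ _ _ e1 (yE 0 erefl).
have a0 := mulr_gt0 al0 mux0; have b0 := mulr_gt0 be0 muy0.
have a1 : alpha * mux < 1 by apply: le_lt_trans aL; rewrite ler_pM2l.
have b1 : beta * muy < 1 by apply: le_lt_trans bL; rewrite ler_pM2l.
have e01 : 0 < eps < 1 / 36 by rewrite e0.
have lnx := ln_le_EG_rate _ _ _ (ltW a0) e01 (xE 1 erefl).
have lny := ln_le_EG_rate _ _ _ (ltW b0) e01 (yE 1 erefl).
have kx0 : 0 <= kx by rewrite divr_ge0//; lra.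
have ky0 : 0 <= ky by rewrite divr_ge0//; lra.
have kxy0 : 0 <= kxy by rewrite divr_ge0// sqrtr_ge0.
(* A step [t] of size at most [m / kap] turns the logarithmic bound into one with condition number
   [kap]. *)
have rate (t kap m : R) : 0 <= kap -> t * kap <= m ->
    ln (1 / eps) <= 16 / 3 * t * K%:R ->
    kap * ln (1 / eps) <= 16 / 3 * m * K%:R.
  move=> kap0 tk /(ler_wpM2l kap0) /le_trans; apply.
  have := ler_wpM2r (ler0n R K) tk; lra.
have akx : alpha * mux * kx <= 1.
  by rewrite -mulrA (mulrC mux) divfK ?gt_eqF// ltW.
have bky : beta * muy * ky <= 1.
  by rewrite -mulrA (mulrC muy) divfK ?gt_eqF// ltW.
have := rate _ _ _ kx0 akx lnx; have := rate _ _ _ ky0 bky lny.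
suff : kxy * ln (1 / eps) <= 16 / 3 * 2 * K%:R by lra.
(* Otherwise the coupled pair alone keeps the squared distance at least [1 / 36 > eps]. *)
have : alpha * beta * Lxy ^+ 2 < 4.
  rewrite ltNge; apply/negP => cd4.
  have := le_trans (le_enorm2_sqr z 2 2) ze; apply/negP; rewrite -ltNge.
  apply: lt_le_trans e1 _; apply: EG_coupled_far => //.
  - by rewrite /hx/= a0.
  - by rewrite /hy/= b0.
  - by rewrite mxE.
move=> cd4.
(* This product equals [alpha * beta * Lxy ^+ 2], so its two factors cannot both exceed 2; a factor
   at most 2 gives the bound through the slow pair. *)
have : (alpha * mux * kxy) * (beta * muy * kxy) < 4.
  apply: le_lt_trans cd4; rewrite le_eqVlt; apply/orP; left; apply/eqP.
  have kxyE : kxy ^+ 2 = Lxy ^+ 2 / (mux * muy).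
    by rewrite /kxy expr_div_n sqr_sqrtr// mulr_ge0// ltW.
  rewrite [LHS](_ : _ = alpha * beta * (mux * muy) * kxy ^+ 2); last by ring.
  by rewrite kxyE; field; rewrite !gt_eqF.
have [ax|ax] := leP (alpha * mux * kxy) 2; first by move=> _; exact: rate lnx.
have [bx|bx] := leP (beta * muy * kxy) 2; first by move=> _; exact: rate lny.
by move=> ab4; exfalso; nra.
Qed.
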